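(* Let $G$ be a cubic graph. Then $G$ is 2FH if and only if $G$ admits a 3-malleable vertex.
   Context: Graphs are finite and connected, may have multiple (parallel) edges, and have no loops. The degree of a vertex is the number of edges incident to it; a cubic graph is a 3-regular graph. A $2$-factor of $G$ is a $2$-regular spanning subgraph (not necessarily connected; two parallel edges count as a $2$-regular component on two vertices), and a Hamiltonian cycle is a connected $2$-factor. A perfect matching is the edge set of a $1$-regular spanning subgraph. A Hamiltonian cycle $H$ extends a perfect matching $M$ if $M\subseteq E(H)$. A graph is 2FH (2-factor Hamiltonian) if it has a Hamiltonian cycle and each of its $2$-factors is a Hamiltonian cycle. For a vertex $v$, $\partial v$ denotes the set of edges incident to $v$. If $G$ admits a perfect matching and $v$ is a vertex of degree $t\ge 2$, then $v$ is $t$-malleable if for every perfect matching $M$ of $G$ there exist Hamiltonian cycles $H_1,\dots,H_{t-1}$ of $G$, all extending $M$, such that $\partial v - M\subset \bigcup_{i=1}^{t-1}E(H_i)$. (In particular, a graph with a $t$-malleable vertex admits a perfect matching.) *)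

(* Defs.v *)
From mathcomp Require Import all_boot.

Set Implicit Arguments.
Unset Strict Implicit.
Unset Printing Implicit Defensive.

(* Finite multigraphs without loops: edges form a type of their own, so that
   parallel edges are distinct elements of [edge] with the same ends, and loops
   are excluded because the two ends of an edge are distinct.  Connectedness is
   a separate predicate, [connectedg]. *)
Record mgraph := MGraph {
  vertex : finType;
  edge : finType;
  ends : edge -> {set vertex};
  card_ends : forall e, #|ends e| = 2
}.

Section MGraph.

Variable G : mgraph.
Implicit Types (F M H : {set edge G}) (v : vertex G).

Definition boundary v : {set edge G} := [set e | v \in ends e].

(* A spanning subgraph of G is represented by its edge set F. *)
Definition degree F v : nat := #|F :&: boundary v|.

Definition regular k F : bool := [forall v, degree F v == k].

Definition adjacent F : rel (vertex G) :=
  [rel x y | [exists e in F, ends e == [set x; y]]].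

(* The graph without vertices is not considered to be connected. *)
Definition connected_spanning F : bool :=
  (0 < #|vertex G|) && [forall x, forall y, connect (adjacent F) x y].

Definition connectedg : bool := connected_spanning [set: edge G].

Definition cubic : bool := regular 3 [set: edge G].

Definition two_factor F : bool := regular 2 F.

Definition hamiltonian_cycle F : bool := two_factor F && connected_spanning F.

Definition perfect_matching M : bool := regular 1 M.

Definition extends H M : bool := M \subset H.

Definition two_factor_hamiltonian : Prop :=
  (exists H, hamiltonian_cycle H) /\
  (forall F, two_factor F -> hamiltonian_cycle F).

Definition malleable (t : nat) v : Prop :=
  [/\ 2 <= t,
      degree [set: edge G] v = t,
      exists M, perfect_matching M &
      forall M, perfect_matching M ->
        exists H : 'I_t.-1 -> {set edge G},
          (forall i, hamiltonian_cycle (H i) /\ extends (H i) M) /\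
          boundary v :\: M \subset \bigcup_(i < t.-1) H i].

End MGraph.

(* Main.v *)
Require Import Defs.
From mathcomp Require Import all_boot.
From mathcomp Require Import all_algebra.

(** If [F] is a 2-factor then [M = ~: F] is a perfect matching.  When G is 2FH,
    [F] is an even cycle, hence contains a perfect matching [P], and
    [M :|: P] and [M :|: (F :\: P)] are Hamiltonian cycles witnessing that
    every vertex is 3-malleable.  Conversely, let [v] be 3-malleable and let [H]
    be a Hamiltonian cycle extending [M].  The perfect matching [N = ~: H] lies
    in [F], and the Hamiltonian cycles extending [N] have the form [N :|: P]
    with [P] one of the at most two perfect matchings of the cycle [H];
    malleability at [v] applied to [N] forces [N :|: P] to be Hamiltonian for
    [P = F :&: H], and this union is [F]. *)

Set Implicit Arguments.
Unset Strict Implicit.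
Unset Printing Implicit Defensive.

Section Multigraph.

Variable G : mgraph.
Implicit Types (F M H P Q : {set edge G}) (v x y : vertex G) (e : edge G).

Lemma degreeD F1 F2 v :
  F1 \subset F2 -> degree (F2 :\: F1) v = degree F2 v - degree F1 v.
Proof.
move=> sF12; rewrite /degree setIDAC cardsD; congr (_ - #|pred_of_set _|).
by rewrite setIAC (setIidPr sF12).
Qed.

Lemma regularD k1 k2 F1 F2 :
  F1 \subset F2 -> regular k1 F1 -> regular k2 F2 ->
  regular (k2 - k1) (F2 :\: F1).
Proof.
move=> sF12 /forallP r1 /forallP r2; apply/forallP => v.
by rewrite degreeD // (eqP (r1 v)) (eqP (r2 v)).
Qed.

Lemma cubic_regularC k F : cubic G -> regular k F -> regular (3 - k) (~: F).
Proof. by move=> cubG rF; rewrite -setTD regularD ?subsetT. Qed.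

Lemma sum_degree F : \sum_v degree F v = 2 * #|F|.
Proof.
transitivity (\sum_v \sum_(e in F | v \in ends e) 1).
  by apply: eq_bigr => v _; rewrite sum1dep_card; apply: eq_card => e; rewrite !inE.
rewrite (exchange_big_dep (mem F)) /=; last by move=> v e _ /andP[].
rewrite -sum1_card big_distrr /=; apply: eq_bigr => e eF.
rewrite -(card_ends e) muln1 -sum1_card.
by apply: eq_bigl => v; rewrite eF.
Qed.

Lemma perfect_matching_even M : perfect_matching M -> ~~ odd #|vertex G|.
Proof.
move=> /forallP rM.
have: \sum_v degree M v = #|vertex G|.
  by rewrite (eq_bigr (fun=> 1)) ?sum1_card // => v _; apply/eqP/rM.
by rewrite sum_degree => <-; rewrite oddM.
Qed.

Lemma adjacentP F x y :
  reflect (exists2 e, e \in F & ends e = [set x; y]) (adjacent F x y).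
Proof.
apply: (iffP existsP) => [[e /andP[eF /eqP]] | [e eF exy]]; exists e => //.
by rewrite eF exy eqxx.
Qed.

(** Connectedness as an induction principle: it spreads equality of kernel entries, and later
    agreement of two matchings, to all vertices. *)
Lemma connected_spanning_ind F (A : pred (vertex G)) x y :
  connected_spanning F ->
  (forall u w, adjacent F u w -> A u -> A w) ->
  A x -> A y.
Proof.
move=> /andP[_ /forallP/(_ x)/forallP/(_ y)/connectP[p + ->]] stepA.
elim: p x => //= z p IHp x /andP[xz zp] xA.
exact: IHp zp (stepA _ _ xz xA).
Qed.

Section EvenCycle.

Import GRing.Theory.
Local Open Scope ring_scope.

(* Over 'F_2, a choice of edges of [F] with odd degree at every vertex is a
   solution [c] of [c *m A = 1] for the incidence matrix [A]; connectedness says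
   that the kernel of [A] consists of constant vectors, which are orthogonal
   to the all-ones vector because the number of vertices is even. *)
Lemma connected_odd_subgraph F :
  connected_spanning F -> ~~ odd #|vertex G| ->
  exists2 P : {set edge G}, P \subset F & forall v, odd (degree P v).
Proof.
move=> connF evenG.
pose A : 'M['F_2]_(#|edge G|, #|vertex G|) := \matrix_(i, j)
  ((enum_val i \in F) && (enum_val j \in ends (enum_val i)))%:R.
have F2add (a b : 'F_2) : a + b = 0 -> a = b.
  by move=> /eqP; rewrite addr_eq0 oppr_pchar2 ?pchar_Fp // => /eqP.
have kerA (z : 'cV_#|vertex G|) : A *m z = 0 ->
    forall i j, z i 0 = z j 0.
  move=> Az i j; apply/eqP.
  rewrite -[i]enum_valK -[j]enum_valK.
  pose B := [pred w | z (enum_rank (enum_val i)) 0 == z (enum_rank w) 0].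
  apply: (@connected_spanning_ind F B (enum_val i)) => //=.
  (* The row of [A] at [e] turns [A *m z = 0] into [z u + z w = 0], which is an equality in
     characteristic 2. *)
  move=> u w /adjacentP[e eF exy] /eqP ->; apply/eqP/F2add.
  have /(congr1 (fun M : 'cV_ _ => M (enum_rank e) 0)) := Az.
  rewrite !mxE (reindex _ (onW_bij _ (@enum_rank_bij _))) /=.
  have uw : u != w by have := card_ends e; rewrite exy cards2; case: eqP.
  rewrite (bigD1 u) // (bigD1 w) 1?eq_sym //= !mxE !enum_rankK eF exy !inE !eqxx.
  rewrite orbT !mul1r big1 ?addr0 // => t /andP[tu tw].
  by rewrite !mxE !enum_rankK exy !inE (negPf tu) (negPf tw) andbF mul0r.
(* The columns of [cokermx A] lie in the kernel of [A], so each is constant and its entries sum to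
   an even multiple of one value. *)
have /submxP[c cA] : ((const_mx 1 : 'rV_#|vertex G|) <= A)%MS.
  rewrite submxE; apply/eqP/rowP => j.
  have kerj : A *m col j (cokermx A) = 0.
    by rewrite colE mulmxA mulmx_coker mul0mx.
  rewrite !mxE; under eq_bigr => i _.
    rewrite mxE mul1r.
    have := kerA _ kerj i j; rewrite !mxE => ->; over.
  rewrite sumr_const card_ord -mulr_natr.
  by apply/eqP; rewrite mulf_eq0 orbC -(dvdn_pcharf (pchar_Fp _)) // dvdn2 evenG.
(* Rows of [A] outside [F] vanish, so restricting the support of [c] to [F] does not change
   [c *m A]. *)
pose P := [set e in F | c 0 (enum_rank e) == 1].
exists P; first by apply/subsetP => e; rewrite inE => /andP[].
move=> v; apply: contraTT (oner_neq0 'F_2) => even_v; apply/negPn/eqP.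
have F2eq (a : 'F_2) : a = (a == 1)%:R by case: a => [[|[|]]] // ?; apply/val_inj.
transitivity ((degree P v)%:R : 'F_2); last first.
  by apply/eqP; rewrite -(dvdn_pcharf (pchar_Fp _)) // dvdn2.
have /(congr1 (fun M : 'rV_ _ => M 0 (enum_rank v))) := cA.
rewrite !mxE (reindex _ (onW_bij _ (@enum_rank_bij _))) /= => cAv.
rewrite [LHS]cAv /degree -[RHS]sumr_const [RHS]big_mkcond; apply: eq_bigr => e _.
rewrite !mxE !enum_rankK [c 0 _]F2eq -natrM mulnb !inE.
by rewrite andbCA andbA; case: ifP.
Qed.

End EvenCycle.

(** An odd degree that is at most 2 equals 1. *)
Lemma hamiltonian_perfect_matching H :
  hamiltonian_cycle H -> ~~ odd #|vertex G| ->
  exists2 P : {set edge G}, P \subset H & perfect_matching P.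
Proof.
move=> /andP[/forallP rH connH] /(connected_odd_subgraph connH)[P sPH oddP].
exists P => //; apply/forallP => v; have := oddP v.
have : degree P v <= 2 by rewrite -(eqP (rH v)) subset_leq_card ?setSI.
by case: (degree P v) => [|[|[]]].
Qed.

Lemma perfect_matching_cover M v :
  perfect_matching M -> exists2 e, e \in M & v \in ends e.
Proof.
move=> /forallP/(_ v)/cards1P[e Mv]; exists e;
by have := set11 e; rewrite -Mv !inE => /andP[].
Qed.

Lemma perfect_matching_incident M v e f :
  perfect_matching M -> e \in M -> v \in ends e -> v \in ends f ->
  (f \in M) = (f == e).
Proof.
move=> /forallP/(_ v)/cards1P[g Mv] eM ve vf.
have inMv h : v \in ends h -> (h \in M) = (h == g).
  by move=> vh; have := in_set1 h g; rewrite -Mv !inE vh andbT.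
by move: eM; rewrite !inMv // => /eqP ->.
Qed.

Lemma two_factor_third H v e f g :
  two_factor H -> [/\ e \in H, f \in H & g \in H] ->
  [/\ v \in ends e, v \in ends f & v \in ends g] ->
  e != f -> (g == e) || (g == f).
Proof.
move=> /forallP/(_ v)/eqP dv [eH fH gH] [ve vf vg] ef.
suff /setP/(_ g) : [set e; f] = H :&: boundary v by rewrite !inE gH vg.
apply/eqP; rewrite eqEcard cards2 ef -[#|_ :&: _|]/(degree H v) dv leqnn andbT.
by apply/subsetP => h /set2P[] ->; rewrite !inE ?eH ?fH.
Qed.

(* The vertices at which [P] and [Q] use the same edge are closed under
   adjacency in [H]. *)
Lemma hamiltonian_perfect_matching_inj H P Q e :
  hamiltonian_cycle H -> perfect_matching P -> perfect_matching Q ->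
  P \subset H -> Q \subset H -> e \in P -> e \in Q -> P = Q.
Proof.
move=> /andP[tfH connH] pmP pmQ sPH sQH eP eQ.
pose common x := [exists f in P :&: Q, x \in ends f].
have ends_inhab f : exists x, x \in ends f.
  by apply/card_gt0P; rewrite card_ends.
have all_common x : common x.
  have [y ey] := ends_inhab e.
  apply: (@connected_spanning_ind H common y) => //; last first.
    by apply/existsP; exists e; rewrite inE eP eQ.
  move=> u w /adjacentP[h hH huw] /existsP[f /andP[/setIP[fP fQ] uf]].
  have [uh wh] : u \in ends h /\ w \in ends h by rewrite huw !inE !eqxx orbT.
  have [hf|hf] := eqVneq h f.
    by apply/existsP; exists f; rewrite inE fP fQ -hf.
  have hP : h \notin P by rewrite (perfect_matching_incident pmP fP uf uh).
  have hQ : h \notin Q by rewrite (perfect_matching_incident pmQ fQ uf uh).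
  have [p pP wp] := perfect_matching_cover w pmP.
  have [q qQ wq] := perfect_matching_cover w pmQ.
  have hp : h != p by apply: contraNneq hP => ->.
  (* [H] has only two edges at [w], and [h] lies outside [Q], so [p] and [q] must coincide. *)
  have : (q == h) || (q == p).
    apply: (@two_factor_third H w) => //.
    by split; [| exact: (subsetP sPH) | exact: (subsetP sQH)].
  case/orP => /eqP eq_q; first by rewrite -eq_q qQ in hQ.
  by apply/existsP; exists p; rewrite inE pP -eq_q qQ.
apply/setP => f; have [x xf] := ends_inhab f.
have /existsP[g /andP[/setIP[gP gQ] xg]] := all_common x.
by rewrite (perfect_matching_incident pmP gP xg xf)
           (perfect_matching_incident pmQ gQ xg xf).
Qed.

End Multigraph.

Theorem theorem2p2 (G : mgraph) (connG : connectedg G) (cubG : cubic G) :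
  two_factor_hamiltonian G <-> exists v : vertex G, malleable 3 v.
Proof.
split=> [[[H hamH] hamF] | [v [_ _ [M pmM] mall]]].
  have [/card_gt0P[v _] _] := andP connG.
  exists v; split=> //; first exact/eqP/(forallP cubG).
    have /andP[rH _] := hamH.
    by exists (~: H); apply: (cubic_regularC cubG rH).
  move=> M pmM.
  have hamC : hamiltonian_cycle (~: M) by apply/hamF/(cubic_regularC cubG pmM).
  have [P sPC pmP] :=
    hamiltonian_perfect_matching hamC (perfect_matching_even pmM).
  pose Q := ~: M :\: P.
  have pmQ : perfect_matching Q by apply: (@regularD _ 1 2) => //; case/andP: hamC.
  (* Since [P] and [Q] partition [~: M], these complements are [M :|: Q] and [M :|: P]; together
     they cover every edge. *)
  exists (fun i => if i == ord0 then ~: P else ~: Q); split=> [i|].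
    case: ifP => _; split.
    - exact/hamF/(cubic_regularC cubG pmP).
    - by rewrite /extends -[M]setCK setCS.
    - exact/hamF/(cubic_regularC cubG pmQ).
    - by rewrite /extends -[M]setCK setCS subsetDl.
  apply/subsetP => e _; apply/bigcupP.
  by have [eP|eP] := boolP (e \in P); [exists ord_max | exists ord0];
    rewrite //= !inE eP.
have hamF (F : {set edge G}) : two_factor F -> hamiltonian_cycle F.
  move=> tfF.
  have [H hamH sMH] : exists2 H, hamiltonian_cycle H & ~: F \subset H.
    have [K [hamK _]] := mall _ (cubic_regularC cubG tfF).
    by exists (K ord0); have [] := hamK ord0.
  have tfH : two_factor H by case/andP: hamH.
  pose N := ~: H.
  have pmN : perfect_matching N by apply: (cubic_regularC cubG tfH).
  have sNF : N \subset F by rewrite -[F]setCK setCS.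
  have pmP : perfect_matching (F :\: N) by apply: (@regularD _ 1 2).
  (* This edge at [v] lies outside [N], so malleability puts it on some [K i]; sharing it forces
     [F :\: N] and [K i :\: N], both matchings inside [H], to be equal. *)
  have [e] : exists e, e \in (F :\: N) :&: boundary v.
    by apply/card_gt0P; rewrite -[#|_|]/(degree _ _) (eqP (forallP pmP v)).
  case/setIP => eP ev.
  have [K [hamK covK]] := mall _ pmN.
  have /bigcupP[i _ eK] : e \in \bigcup_(i < 2) K i.
    by apply: (subsetP covK); rewrite in_setD ev andbT; case/setDP: eP.
  have [hamKi sNK] := hamK i.
  have sub X : X :\: N \subset H.
    by apply/subsetP => f; rewrite !inE negbK => /andP[].
  have pmQ : perfect_matching (K i :\: N).
    by apply: (@regularD _ 1 2) => //; case/andP: hamKi.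
  have eqPQ : F :\: N = K i :\: N.
    apply: (@hamiltonian_perfect_matching_inj _ H _ _ e) => //.
    by rewrite in_setD eK andbT; case/setDP: eP.
  (* [F] and [K i] both contain [N] and agree outside it, so [F] is the Hamiltonian cycle [K i]. *)
  by rewrite -(setID F N) (setIidPr sNF) eqPQ -{1}(setIidPr sNK) setID.
split=> //; have [K [hamK _]] := mall _ pmM.
by exists (K ord0); have [] := hamK ord0.
Qed.
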